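(* For every $n\in\mathbb{N}^*$ and every boolean function $f:\{-1,1\}^n\to\{-1,1\}$, $$\sum_{k\in[n]} -I_k(f)\log I_k(f)\leq 2\,\mathbb{E}|\mathcal{S}_f|^2 = 2\sum_{S\subseteq[n]}|S|^2\hat f(S)^2,$$ with the convention $I_k(f)\log I_k(f)=0$ when $I_k(f)=0$.
   Context: $\{-1,1\}^n$ carries the uniform probability measure, $[n]=\{1,\dots,n\}$. For $S\subseteq[n]$, $X_S(x)=\prod_{i\in S}x_i$ (with $X_\emptyset=1$), and the Fourier coefficients are $\hat f(S)=2^{-n}\sum_{x}f(x)X_S(x)$, so $f=\sum_S\hat f(S)X_S$. For $k\in[n]$, $\mu_k(x)$ denotes $x$ with its $k$-th coordinate flipped, and the influence is $I_k(f)=\mathbb{P}_x(f(x)\neq f(\mu_k(x)))$, which equals $\sum_{S\ni k}\hat f(S)^2$. The spectral sample $\mathcal{S}_f$ is the random subset of $[n]$ with $\mathbb{P}(\mathcal{S}_f=S)=\hat f(S)^2$. Here $\log$ is the natural logarithm. *)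

(* Defs.v *)
From HB Require Import structures.
From mathcomp Require Import all_boot all_order all_algebra.
From mathcomp Require Import all_classical all_reals all_analysis.

Set Implicit Arguments.
Unset Strict Implicit.
Unset Printing Implicit Defensive.

Import Order.TTheory GRing.Theory Num.Theory.
Local Open Scope ring_scope.

(* The two-point set {-1, 1} is encoded as [bool], [b] standing for (-1)^b:
   [true] is -1 and [false] is 1; [sgn] is the embedding into the reals. *)
Definition sgn (R : realType) (b : bool) : R := (-1) ^+ b.

Definition cube (n : nat) : finType := {ffun 'I_n -> bool}.

Definition flip n (k : 'I_n) (x : cube n) : cube n :=
  [ffun i => if i == k then ~~ x i else x i].

Definition walsh (R : realType) n (S : {set 'I_n}) (x : cube n) : R :=
  \prod_(i in S) sgn R (x i).

Definition fourier (R : realType) n (f : cube n -> bool) (S : {set 'I_n}) : R :=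
  (2 ^+ n)^-1 * \sum_(x : cube n) sgn R (f x) * walsh R S x.

(* Probability of [f x != f (flip k x)] for [x] uniform on the cube, which has
   [2 ^ n] points. *)
Definition influence (R : realType) n (f : cube n -> bool) (k : 'I_n) : R :=
  #|[pred x : cube n | f x != f (flip k x)]|%:R / 2 ^+ n.

Lemma sum_walsh (R : realType) n (x y : cube n) :
  \sum_(S : {set 'I_n}) walsh R S x * walsh R S y = 2 ^+ n * (x == y)%:R.
Proof.
have -> : \sum_(S : {set 'I_n}) walsh R S x * walsh R S y =
    \prod_(i < n) (sgn R (x i) * sgn R (y i) + 1).
  rewrite bigA_distr; apply: eq_bigr => S _.
  by rewrite -big_split /= -big_mkcond.
have [<-|xy] := eqVneq x y.
  rewrite mulr1 (eq_bigr (fun=> 2)) ?prodr_const ?card_ord// => i _.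
  by rewrite /sgn; case: (x i); rewrite ?expr1 ?expr0 ?mulrNN ?mulr1.
rewrite mulr0; have [i xyi] : exists i, x i != y i.
  apply/existsP; rewrite -negb_forall; apply: contra xy => /forallP xy.
  by apply/eqP/ffunP => i; apply/eqP.
rewrite (bigD1 i)//=; case: (x i) (y i) xyi => -[]// _;
  by rewrite /sgn /= ?expr1 ?expr0 ?mulr1 ?mul1r addNr mul0r.
Qed.

Lemma parseval (R : realType) n (f : cube n -> bool) :
  \sum_(S : {set 'I_n}) fourier R f S ^+ 2 = 1.
Proof.
have -> : \sum_(S : {set 'I_n}) fourier R f S ^+ 2 =
    \sum_(S : {set 'I_n}) \sum_(x : cube n) \sum_(y : cube n)
      (2 ^+ n) ^- 2 * (sgn R (f x) * sgn R (f y)) * (walsh R S x * walsh R S y).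
  apply: eq_bigr => S _; rewrite /fourier exprMn exprVn (expr2 (\sum_x _)).
  rewrite mulr_suml mulr_sumr; apply: eq_bigr => x _.
  rewrite !mulr_sumr; apply: eq_bigr => y _.
  by rewrite -[in RHS]mulrA; congr (_ * _); rewrite mulrACA.
rewrite exchange_big /= (eq_bigr (fun=> (2 ^+ n)^-1)); last first.
  move=> x _; rewrite exchange_big /= (bigD1 x) //= (big1 _ (predC1 x)) ?addr0; last first.
    by move=> y yx; rewrite -mulr_sumr sum_walsh eq_sym (negbTE yx) !mulr0.
  rewrite -mulr_sumr sum_walsh eqxx mulr1 -expr2 sqrr_sign mulr1.
  by rewrite expr2 invfM -mulrA mulVf ?mulr1// expf_neq0// pnatr_eq0.
rewrite sumr_const card_ffun card_bool card_ord.
by rewrite -[LHS]mulr_natr natrX mulVf// expf_neq0// pnatr_eq0.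
Qed.

HB.instance Definition _ n := isPointed.Build {set 'I_n} finset.set0.

HB.instance Definition _ n := @isMeasurable.Build default_measure_display
  {set 'I_n} discrete_measurable discrete_measurable0 discrete_measurableC
  discrete_measurableU.

(* Law of the spectral sample, as a measure on the discrete space of all subsets
   of [n]: the subset [S] has mass [fourier R f S ^+ 2]. *)
Definition spectral_sample (R : realType) n (f : cube n -> bool)
    (A : set {set 'I_n}) : \bar R :=
  (\sum_(S : {set 'I_n}) (fourier R f S ^+ 2)%:E * \d_S A)%E.

Section spectral_sample_probability.
Local Open Scope classical_set_scope.
Local Open Scope ereal_scope.
Context (R : realType) (n : nat) (f : cube n -> bool).
Local Notation mu := (spectral_sample R f).

Let mu0 : mu set0 = 0.
Proof. by rewrite /mu big1// => S _; rewrite measure0 mule0. Qed.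

Let mu_ge0 A : 0 <= mu A.
Proof. by apply: sume_ge0 => S _; rewrite mule_ge0// lee_fin sqr_ge0. Qed.

Let mu_sigma_additive : semi_sigma_additive mu.
Proof.
move=> F mF tF mUF; rewrite [X in _ --> X](_ : _ =
    lim ((fun m => \sum_(0 <= i < m) mu (F i)) @ \oo)).
  by apply: is_cvg_ereal_nneg_natsum => k _; exact: mu_ge0.
rewrite nneseries_sum; last by move=> S j _; rewrite mule_ge0// lee_fin sqr_ge0.
apply: eq_bigr => S _.
rewrite nneseriesZl//.
by congr (_ * _); exact: measure_semi_bigcup.
Qed.

HB.instance Definition _ := isMeasure.Build _ _ _ mu mu0 mu_ge0 mu_sigma_additive.

Let mu_setT : mu setT = 1.
Proof.
rewrite /mu; under eq_bigr do rewrite diracT mule1.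
by rewrite sumEFin parseval.
Qed.

HB.instance Definition _ := Measure_isProbability.Build _ _ _ mu mu_setT.

End spectral_sample_probability.

(* Main.v *)
(* Let A_k be the set of points where flipping coordinate k changes f, so that
   I_k = |A_k| / 2^n. The edge-isoperimetric inequality, proved by splitting A
   along a coordinate on which it is not constant, bounds the entropy term
   - I_k log I_k by the density of the edge boundary of A_k. On a boundary edge
   in direction j the second derivative D_j D_k f is at least 1/2 in absolute
   value, so by Parseval this density is at most
   2 sum_j ||D_j D_k f||^2 = 2 sum_(S containing k) |S| fhat(S)^2.
   It remains to sum over k. *)

Require Import Defs.
From mathcomp Require Import all_boot all_order all_algebra.
From mathcomp Require Import all_classical all_reals all_analysis.
From mathcomp Require Import ring lra zify.

Import Order.TTheory GRing.Theory Num.Theory.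
Local Open Scope ring_scope.

Set Implicit Arguments.
Unset Strict Implicit.

(** * Flips, facets and edges inside a subset of the cube *)

Lemma flipK n (k : 'I_n) : involutive (flip k).
Proof. by move=> x; apply/ffunP => i; rewrite !ffunE; case: eqP; rewrite ?negbK. Qed.

Lemma flip_neq n (i k : 'I_n) (x : cube n) : i != k -> flip k x i = x i.
Proof. by rewrite ffunE => /negbTE ->. Qed.

Lemma flip_eq n (k : 'I_n) (x : cube n) : flip k x k = ~~ x k.
Proof. by rewrite ffunE eqxx. Qed.

Lemma sum_flip (V : nmodType) n (k : 'I_n) (F : cube n -> V) :
  \sum_x F (flip k x) = \sum_x F x.
Proof. by rewrite [RHS](reindex_inj (inv_inj (flipK k))). Qed.

(** Each edge inside [A] is counted twice, once from each endpoint. *)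
Definition inner_edges n (A : {set cube n}) : nat :=
  \sum_(x in A) \sum_(j < n) (flip j x \in A).

Definition facet n (A : {set cube n}) (i : 'I_n) (b : bool) : {set cube n} :=
  [set x in A | x i == b].

Lemma card_facets n (A : {set cube n}) (i : 'I_n) :
  #|A| = (#|facet A i true| + #|facet A i false|)%N.
Proof.
rewrite -(cardsID [set x : cube n | x i == true] A); congr (_ + _)%N.
  by apply: eq_card => x; rewrite !inE.
by apply: eq_card => x; rewrite !inE andbC; case: (x i).
Qed.

Lemma sum_facets n (A : {set cube n}) (i : 'I_n) (F : cube n -> nat) :
  (\sum_(x in A) F x =
    \sum_(x in facet A i true) F x + \sum_(x in facet A i false) F x)%N.
Proof.
rewrite (bigID (fun x : cube n => x i)) /=; congr (_ + _)%N.
  by apply: eq_bigl => x; rewrite inE eqb_id.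
by apply: eq_bigl => x; rewrite inE eqbF_neg.
Qed.

(** [flip i] is injective, so it matches points of one facet with distinct points of the other. *)
Lemma card_crossing n (A : {set cube n}) (i : 'I_n) (b : bool) :
  (\sum_(x in facet A i b) (flip i x \in facet A i (~~ b)) <=
   minn #|facet A i b| #|facet A i (~~ b)|)%N.
Proof.
rewrite leq_min; apply/andP; split.
  by rewrite -sum1_card; apply: leq_sum => x _; exact: leq_b1.
rewrite -sum1_card [leqRHS](reindex_inj (inv_inj (flipK i)))/=.
rewrite big_mkcond [leqRHS]big_mkcond/=; apply: leq_sum => x _.
by case: ifP => // _; case: ifP.
Qed.

(** A flip in a direction other than [i] keeps coordinate [i]; direction [i] itself yields the
    crossing edges. *)
Lemma inner_edges_facet n (A : {set cube n}) (i : 'I_n) (b : bool) :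
  (\sum_(x in facet A i b) \sum_(j < n) (flip j x \in A) <=
   inner_edges (facet A i b) + minn #|facet A i b| #|facet A i (~~ b)|)%N.
Proof.
apply: leq_trans (leq_add (leqnn _) (card_crossing A i b)).
rewrite -big_split; apply: leq_sum => x; rewrite inE => /andP[_ /eqP xi] /=.
rewrite (bigD1 i)//= [in leqRHS](bigD1 i)//= addnAC; apply: leq_add.
  by rewrite [flip i x \in facet A i (~~ b)]inE flip_eq xi eqxx andbT leq_addl.
apply: leq_sum => j ji; rewrite inE flip_neq 1?eq_sym// xi eqxx andbT//.
Qed.

Lemma inner_edges_split n (A : {set cube n}) (i : 'I_n) :
  (inner_edges A <= inner_edges (facet A i true) + inner_edges (facet A i false)
    + 2 * minn #|facet A i true| #|facet A i false|)%N.
Proof.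
rewrite {1}/inner_edges (sum_facets A i).
have := inner_edges_facet A i true; have := inner_edges_facet A i false.
rewrite /= [minn #|facet A i false| _]minnC => h0 h1.
by rewrite mul2n -addnn addnACA; exact: leq_add.
Qed.

Lemma inner_edges_le n (A : {set cube n}) : (inner_edges A <= n * #|A|)%N.
Proof.
rewrite mulnC -sum_nat_const; apply: leq_sum => x _.
rewrite -[leqRHS]card_ord -sum1_card; apply: leq_sum => j _; exact: leq_b1.
Qed.

(** * Two-point entropy inequality and edge-isoperimetry *)

Section two_point.
Variable R : realType.
Implicit Types a b : R.

Lemma ln2_le1 : ln 2 <= 1 :> R.
Proof. by have := @le_ln1Dx R 1; rewrite -natr1 addrC; apply; lra. Qed.

(* With [b = a + d], the difference of the two sides is
   [a ln ((a + b)^2 / (4 a b)) + d ln ((a + b) / b)]. *)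
Lemma two_point_entropy a b : 0 < a -> a <= b ->
  a * ln a + b * ln b + 2 * a * ln 2 <= (a + b) * ln (a + b).
Proof.
move=> a0 ab; have b0 : 0 < b by lra.
have amgm : ln 2 + ln 2 + (ln a + ln b) <= ln (a + b) + ln (a + b).
  rewrite -!lnM ?posrE ?mulr_gt0 ?addr_gt0//.
  rewrite ler_ln ?posrE ?mulr_gt0 ?addr_gt0//; nra.
have le_b : ln b <= ln (a + b) by rewrite ler_ln ?posrE ?addr_gt0//; lra.
nra.
Qed.

(** The term in [minn a b] pays for the edges between two facets of sizes [a] and [b]. *)
Lemma two_point_entropy_min (a b : nat) : (0 < a)%N -> (0 < b)%N ->
  a%:R * ln a%:R + b%:R * ln b%:R + 2 * (minn a b)%:R * ln 2 <=
  (a + b)%:R * ln (a + b)%:R :> R.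
Proof.
wlog ab : a b / (a <= b)%N.
  move=> H a0 b0; case/orP: (leq_total a b) => [/H /(_ a0 b0) //|/H /(_ b0 a0)].
  by rewrite minnC [(b + a)%N]addnC [X in X + _ <= _]addrC.
move=> a0 b0; rewrite (minn_idPl ab) natrD.
by apply: two_point_entropy; rewrite ?ltr0n ?ler_nat.
Qed.
End two_point.

(** Strong induction on [#|A|]: the two-point inequality absorbs the edges between the two facets.
    Subcubes give equality. *)
Lemma edge_isoperimetry (R : realType) n (A : {set cube n}) :
  ln 2 * (inner_edges A)%:R <= #|A|%:R * ln #|A|%:R :> R.
Proof.
have [m] := ubnP #|A|; elim: m A => // m IH A; rewrite ltnS => Am.
have [/card_le1P A1|/card_gt1P[x [y [xA yA xy]]]] := leqP #|A| 1.
  rewrite [inner_edges A]big1 ?mulr0 ?mulr_natl.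
    case: #|A| => [|k]; first by rewrite mulr0n.
    by rewrite mulrn_wge0// ln_ge0// ler1n.
  (* No flip fixes a point, so a singleton has no inner edge. *)
  move=> x xA; rewrite big1// => j _; rewrite (A1 x xA) !inE.
  by apply/eqP; rewrite eqb0; apply/eqP => /ffunP/(_ j); rewrite flip_eq; case: (x j).
have [i xyi] : exists i, x i != y i.
  apply/existsP; rewrite -negb_forall; apply: contra xy => /forallP xy.
  by apply/eqP/ffunP => i; apply/eqP.
(* [x] and [y] lie in opposite facets, so both facets are nonempty and hence smaller than [A]. *)
have gt0 b : (0 < #|facet A i b|)%N.
  apply/card_gt0P; case: (eqVneq (x i) b) => [xb|xb]; [exists x|exists y].
    by rewrite inE xA xb eqxx.
  by rewrite inE yA; case: (x i) (y i) b xyi xb => [] [] [].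
have cA := card_facets A i.
have {}IH b : ln 2 * (inner_edges (facet A i b))%:R <=
    #|facet A i b|%:R * ln #|facet A i b|%:R :> R.
  by apply: IH; have := gt0 true; have := gt0 false; case: b; lia.
have := two_point_entropy_min R (gt0 true) (gt0 false); rewrite -cA.
have := inner_edges_split A i; rewrite mul2n -addnn -(ler_nat R) !natrD.
have := IH true; have := IH false.
have : 0 <= ln 2 :> R by rewrite ln_ge0// ler1n.
nra.
Qed.

(** * Fourier coefficients of real functions and discrete derivatives *)

Section fourier_real.
Variables (R : realType) (n : nat).
Implicit Types (g : cube n -> R) (S : {set 'I_n}) (k j : 'I_n).

Definition rfourier g S : R :=
  (2 ^+ n)^-1 * \sum_(x : cube n) g x * walsh R S x.

(** The factor 1/2 makes this the projection onto the Walsh functions with [k \in S]. *)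
Definition deriv k g (x : cube n) : R := (g x - g (flip k x)) / 2.

Lemma parseval_real g :
  \sum_(S : {set 'I_n}) rfourier g S ^+ 2 =
  (2 ^+ n)^-1 * \sum_(x : cube n) g x ^+ 2.
Proof.
have -> : \sum_(S : {set 'I_n}) rfourier g S ^+ 2 =
    \sum_(S : {set 'I_n}) \sum_(x : cube n) \sum_(y : cube n)
      (2 ^+ n) ^- 2 * (g x * g y) * (walsh R S x * walsh R S y).
  apply: eq_bigr => S _; rewrite /rfourier exprMn exprVn (expr2 (\sum_x _)).
  rewrite mulr_suml mulr_sumr; apply: eq_bigr => x _.
  by rewrite !mulr_sumr; apply: eq_bigr => y _; ring.
rewrite exchange_big mulr_sumr; apply: eq_bigr => x _ /=.
rewrite exchange_big /= (bigD1 x) //= (big1 _ (predC1 x)) ?addr0; last first.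
  by move=> y yx; rewrite -mulr_sumr sum_walsh eq_sym (negbTE yx) !mulr0.
rewrite -mulr_sumr sum_walsh eqxx mulr1; field.
by rewrite expf_neq0// pnatr_eq0.
Qed.

Lemma walsh_flip S k x : walsh R S (flip k x) = (-1) ^+ (k \in S) * walsh R S x.
Proof.
rewrite /walsh; have [kS|kS] := boolP (k \in S).
  rewrite (bigD1 k)//= [in RHS](bigD1 k)//= flip_eq /sgn signrN expr1 !mulNr mul1r.
  by congr (- (_ * _)); apply: eq_bigr => i /andP[_ ik]; rewrite flip_neq.
rewrite expr0 mul1r; apply: eq_bigr => i iS; rewrite flip_neq//.
by apply: contraNneq kS => <-.
Qed.

(** Reindexing by [flip k] moves the flip onto [walsh], which changes sign exactly when [k \in S];
    the two sums then add up or cancel. *)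
Lemma rfourier_deriv k g S :
  rfourier (deriv k g) S = (k \in S)%:R * rfourier g S.
Proof.
rewrite /rfourier mulrCA; congr (_ * _).
have -> : \sum_x deriv k g x * walsh R S x =
    2^-1 * (\sum_x g x * walsh R S x - \sum_x g (flip k x) * walsh R S x).
  rewrite -sumrB mulr_sumr; apply: eq_bigr => x _; rewrite /deriv; ring.
rewrite -[\sum_x g (flip k x) * _](sum_flip k).
rewrite [X in _ - X](eq_bigr (fun x => (-1) ^+ (k \in S) * (g x * walsh R S x))).
  by rewrite -mulr_sumr; case: (k \in S); rewrite /= ?expr1 ?expr0; field.
by move=> x _; rewrite flipK walsh_flip mulrCA.
Qed.

Lemma sum_sqr_deriv2 j k g :
  \sum_(S : {set 'I_n}) (j \in S)%:R * (k \in S)%:R * rfourier g S ^+ 2 =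
  (2 ^+ n)^-1 * \sum_x deriv j (deriv k g) x ^+ 2.
Proof.
rewrite -parseval_real; apply: eq_bigr => S _; rewrite !rfourier_deriv.
by case: (j \in S); case: (k \in S); rewrite ?(mul0r, mul1r, expr0n).
Qed.

End fourier_real.

(** * Entropy of the influences *)

Section influence_entropy.
Variables (R : realType) (n : nat) (f : cube n -> bool).
Implicit Types (k j : 'I_n) (x : cube n).

Definition pivotal k : {set cube n} := [set x | f x != f (flip k x)].

(** The first derivative is 1 or -1 on [pivotal k] and 0 elsewhere. If exactly one of [x] and
    [flip j x] is pivotal, halving the difference gives 1/2 in absolute value, with square 1/4. *)
Lemma sqr_deriv2_ge j k x :
  let ind y : R := (y \in pivotal k)%:R in
  (ind x * (1 - ind (flip j x)) + ind (flip j x) * (1 - ind x)) / 4 <=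
  deriv j (deriv k (fun y => sgn R (f y))) x ^+ 2.
Proof.
rewrite /= !inE /deriv /sgn.
by case: (f x); case: (f (flip k x)); case: (f (flip j x));
  case: (f (flip k (flip j x))); rewrite /= ?expr1 ?expr0; nra.
Qed.

Lemma edge_boundary_le_deriv2 k :
  (n * #|pivotal k|)%:R - (inner_edges (pivotal k))%:R <=
  2 * \sum_j \sum_x deriv j (deriv k (fun y => sgn R (f y))) x ^+ 2.
Proof.
pose ind y : R := (y \in pivotal k)%:R.
have -> : (n * #|pivotal k|)%:R - (inner_edges (pivotal k))%:R =
    \sum_(j < n) \sum_x ind x * (1 - ind (flip j x)).
  rewrite exchange_big /= (eq_bigr (fun x => ind x * n%:R -
      ind x * \sum_(j < n) ind (flip j x))); last first.
    move=> x _; rewrite -mulr_sumr -mulrBr; congr (_ * _).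
    by rewrite sumrB sumr_const card_ord.
  rewrite sumrB -mulr_suml mulrC natrM; congr (_ * _ - _).
    rewrite -sum1_card natr_sum big_mkcond; apply: eq_bigr => x _.
    by rewrite /ind; case: ifP.
  rewrite natr_sum big_mkcond; apply: eq_bigr => x _.
  by rewrite /ind; case: ifP; rewrite ?mul0r// mul1r natr_sum.
rewrite mulr_sumr; apply: ler_sum => j _.
(* Each boundary edge is seen from its inner and its outer endpoint; two contributions of 1/4 give
   the factor 2. *)
have sym : \sum_x ind (flip j x) * (1 - ind x) =
    \sum_x ind x * (1 - ind (flip j x)).
  by rewrite -(sum_flip j); apply: eq_bigr => x _; rewrite flipK.
have : \sum_x (ind x * (1 - ind (flip j x)) + ind (flip j x) * (1 - ind x)) / 4
   <= \sum_x deriv j (deriv k (fun y => sgn R (f y))) x ^+ 2.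
  by apply: ler_sum => x _; exact: sqr_deriv2_ge.
rewrite -mulr_suml big_split /= sym; lra.
Qed.

Lemma influenceE k : influence R f k = #|pivotal k|%:R / 2 ^+ n.
Proof. by rewrite /influence; congr (_%:R / _); apply: eq_card => x; rewrite !inE. Qed.

Lemma influence_entropy_le k :
  - influence R f k * ln (influence R f k) <=
  2 * \sum_(S : {set 'I_n}) (k \in S)%:R * (#|S|%:R * fourier R f S ^+ 2).
Proof.
have N0 : 0 < 2 ^+ n :> R by rewrite exprn_gt0.
(* [#|S|] is the sum over [j] of the indicators of [j \in S]. *)
have -> : \sum_(S : {set 'I_n}) (k \in S)%:R * (#|S|%:R * fourier R f S ^+ 2) =
    (2 ^+ n)^-1 * \sum_j \sum_x deriv j (deriv k (fun y => sgn R (f y))) x ^+ 2.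
  rewrite mulr_sumr; under [RHS]eq_bigr do rewrite -sum_sqr_deriv2.
  rewrite exchange_big /=; apply: eq_bigr => S _.
  rewrite -!mulr_suml mulrA mulrC [RHS]mulrC; congr (_ * _).
  rewrite mulrC; congr (_ * _); rewrite -sum1_card natr_sum big_mkcond.
  by apply: eq_bigr => j _; case: ifP.
rewrite mulrCA ler_pdivlMl// influenceE.
apply: le_trans (edge_boundary_le_deriv2 k).
have iso := edge_isoperimetry R (pivotal k).
have [a0|a0] := posnP #|pivotal k|.
  by rewrite a0 !mul0r oppr0 mul0r mulr0 subr_ge0 ler_nat -a0 inner_edges_le.
rewrite ln_div ?posrE ?ltr0n// lnXn ?ltr0n//.
rewrite [X in X <= _](_ : _ = ln 2 * (n * #|pivotal k|)%:R
   - #|pivotal k|%:R * ln #|pivotal k|%:R); last first.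
  by rewrite natrM -mulr_natl; field; rewrite gt_eqF.
(* By isoperimetry the left side is at most [ln 2] times the edge boundary, which is nonnegative;
   conclude with [ln 2 <= 1]. *)
have := inner_edges_le (pivotal k); rewrite -(ler_nat R).
have := ln2_le1 R; nra.
Qed.

(** Summing the indicators of [k \in S] over [k] supplies the second factor [#|S|]. *)
Lemma sum_influence_entropy_le :
  \sum_(k < n) - influence R f k * ln (influence R f k) <=
  2 * \sum_(S : {set 'I_n}) #|S|%:R ^+ 2 * fourier R f S ^+ 2.
Proof.
apply: le_trans (ler_sum _ (fun k _ => influence_entropy_le k)) _.
rewrite -mulr_sumr exchange_big /= ler_pM2l//; apply: ler_sum => S _.
rewrite -mulr_suml (expr2 #|S|%:R) -mulrA; apply: ler_wpM2r.
  by rewrite mulr_ge0// sqr_ge0.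
by rewrite -sum1_card natr_sum [leRHS]big_mkcond; apply: ler_sum => k _; case: ifP.
Qed.

End influence_entropy.

(** * Expectation under the spectral sample *)

Lemma expectation_spectral_sample (R : realType) n (f : cube n -> bool)
    (X : {set 'I_n} -> R) : (forall S, 0 <= X S) ->
  ('E_(spectral_sample R f)[X] =
   (\sum_(S : {set 'I_n}) X S * fourier R f S ^+ 2)%:E)%E.
Proof.
move=> X0; rewrite unlock.
(* Split the finite space into singletons, on each of which [X] is constant. *)
have -> : [set: {set 'I_n}]%classic =
    (\big[setU/set0]_(S <- enum {set 'I_n}) [set S])%classic.
  by rewrite -bigcup_seq; apply/esym/seteqP; split => // S _; exists S; rewrite //= mem_enum.
rewrite ge0_integral_bigsetU//; last 3 first.
- exact: enum_uniq.
- by move=> S T _ _ [U [/= -> ->]].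
- by move=> S _; rewrite lee_fin.
rewrite big_enum -sumEFin /=; apply: eq_bigr => S _.
rewrite (eq_integral (cst (X S)%:E)); last first.
  by move=> T; rewrite inE /= => ->.
rewrite integral_cst// EFinM; congr (_ * _)%E.
(* Only the Dirac mass at [S] charges the singleton of [S]. *)
rewrite /= /spectral_sample (bigD1 S)//= big1 ?adde0.
  by rewrite diracE mem_set// mule1.
by move=> T TS; rewrite diracE memNset ?mule0//=; apply/eqP.
Qed.

Unset Implicit Arguments.

(* Since [0 * _ = 0], a vanishing influence contributes 0. *)
Theorem theorem4p2p3 (R : realType) (n : nat) (n_gt0 : (0 < n)%N)
    (f : cube n -> bool) :
  ((\sum_(k < n) - influence R f k * ln (influence R f k))%:E <=
     2%:E * 'E_(spectral_sample R f)[fun S : {set 'I_n} => (#|S|%:R ^+ 2)%R])%E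
  /\ (2%:E * 'E_(spectral_sample R f)[fun S : {set 'I_n} => (#|S|%:R ^+ 2)%R])%E =
     (2 * \sum_(S : {set 'I_n}) #|S|%:R ^+ 2 * fourier R f S ^+ 2)%:E.
Proof.
rewrite expectation_spectral_sample => [|S]; last exact: sqr_ge0.
by rewrite -EFinM lee_fin; split=> //; exact: sum_influence_entropy_le.
Qed.
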